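(* Let $n\ge1$ and $\delta\in(0,1/3)$. Suppose that: (a) $(X,Y),(X_1,Y_1),\dots,(X_n,Y_n)$ are independent and identically distributed; (b) conditionally on $X$, the noise $\varepsilon=Y-g(X)$ is sub-Gaussian with parameter $\sigma^2>0$: $\mathbb E[\varepsilon\mid X]=0$ and $\mathbb E[\exp(s\varepsilon)\mid X]\le\exp(s^2\sigma^2/2)$ for all $s\in\mathbb R$; (c) $g$ is $L$-Lipschitz on $S_X$ with respect to $\|\cdot\|_2$; (d) there is a function $\ell:S_X\to(0,\infty)$ such that, almost surely, $P^X(\mathcal V(x))\ge\ell(x)\lambda(\mathcal V(x))$ for all $x\in S_X$; (e) the local map $\mathcal V$ is VC with dimension $v$ and is $(\delta,n)$-large. Then, with probability at least $1-3\delta$, for all $x\in S_X$, $$|\hat g_{\mathcal V}(x)-g(x)|\le\sqrt{\frac{3\sigma^2}{n\,\ell(x)\,\lambda(\mathcal V(x))}\log\left(\frac{(n+1)^v}{\delta}\right)}+L(\mathcal V(x))\,\mathrm{diam}(\mathcal V(x)).$$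
   Context: $(X,Y)$ is a random vector with $X\in S_X\subset\mathbb R^d$ ($d\ge1$) and $Y\in\mathbb R$; $g(x)=\mathbb E[Y\mid X=x]$; $P^X$ is the law of $X$; $nP_n^X(A)=\sum_{i=1}^n\mathbf 1_A(X_i)$; $\lambda$ is Lebesgue measure on $\mathbb R^d$. A local map is a mapping $\mathcal V:S_X\to\mathcal B(S_X)$ (Borel subsets of $S_X$) with $x\in\mathcal V(x)$ for all $x$; it may be random and depend on the full sample and on additional randomness ($P^X(\mathcal V(x))$ is then the measure $P^X$ evaluated at the random set $\mathcal V(x)$). The associated estimator is $\hat g_{\mathcal V}(x)=\sum_{i=1}^nY_i\mathbf 1_{\mathcal V(x)}(X_i)/\sum_{i=1}^n\mathbf 1_{\mathcal V(x)}(X_i)$, with $0/0=0$. For a collection $\mathcal A$ of subsets of $\mathbb R^d$, $\mathbb S_{\mathcal A}(n)$ is the supremum over $n$ distinct points $z_1,\dots,z_n\in\mathbb R^d$ of the cardinality of $\{(\mathbf 1_A(z_1),\dots,\mathbf 1_A(z_n)):A\in\mathcal A\}$, and $vc(\mathcal A)=\max\{n\ge1:\mathbb S_{\mathcal A}(n)=2^n\}$. $\mathcal V$ is VC with dimension $v$ if $\{\mathcal V(x):x\in S_X\}\subset\mathcal A$ for a fixed (deterministic) collection $\mathcal A$ with $vc(\mathcal A)=v$. A VC local map with dimension $v>0$ is $(\delta,n)$-large if, almost surely, for all $x\in S_X$, $$n\max\{P_n^X(\mathcal V(x)),P^X(\mathcal V(x))\}\ge36\log\left(\frac{4(2n+1)^v}{\delta}\right).$$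 For $V\subset S_X$, $L(V)$ is the smallest constant $c$ such that $|g(x)-g(y)|\le c\|x-y\|_2$ for all $x,y\in V$, and $\mathrm{diam}(V)=\sup_{x,y\in V}\|x-y\|_2$. The bound is read as $+\infty$ when $\lambda(\mathcal V(x))=0$.
   Formalization: The collection 𝒜 is also assumed measurable in the empirical-process sense: for all m and b in {0,1}^m, the set of (z_1,…,z_m) on which some A in 𝒜 has trace b is universally measurable; without this the claim fails under the continuum hypothesis. *)

(* Defs.v *)
From HB Require Import structures.
From mathcomp Require Import all_boot all_order all_algebra.
From mathcomp Require Import all_classical all_reals all_analysis.
Set Implicit Arguments.
Unset Strict Implicit.
Unset Printing Implicit Defensive.
Import Order.TTheory GRing.Theory Num.Theory.
Import numFieldNormedType.Exports.
Local Open Scope classical_set_scope.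
Local Open Scope ring_scope.
Local Open Scope ereal_scope.

(* Points of R^d are the tuples d.-tuple R, whose measurable structure is the
   product (Borel) sigma-algebra. *)

Section Euclidean.
Context {R : realType} {d : nat}.

Definition l2dist (x y : d.-tuple R) : R :=
  Num.sqrt (\sum_(i < d) (tnth x i - tnth y i) ^+ 2)%R.

Definition diam2 (V : set (d.-tuple R)) : \bar R :=
  ereal_sup [set (l2dist x y)%:E | x in V & y in V].

(* Least Lipschitz constant of g on V, +oo if there is none.  The condition
   0 <= c only matters when V has at most one point. *)
Definition lip_const (g : d.-tuple R -> R) (V : set (d.-tuple R)) : \bar R :=
  ereal_inf [set c%:E | c in
    [set c : R | (0 <= c)%R /\ forall x y, V x -> V y ->
      (`|g x - g y| <= c * l2dist x y)%R]].

End Euclidean.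

(* Lebesgue measure on R^d, as the d-fold product of the one-dimensional one
   (on Borel sets). *)
Fixpoint lebesgue_tuple {R : realType} (d : nat) :
    set (d.-tuple R) -> \bar R :=
  match d with
  | 0 => fun A => \d_([tuple] : 0.-tuple R) A
  | d'.+1 => fun A => \int[lebesgue_measure]_(x in [set: R])
      lebesgue_tuple [set t : d'.-tuple R | A [tuple of x :: t]]
  end.

Section VC.
Context {T : eqType}.
Implicit Types A : set (set T).

Definition realizes A m (b : {ffun 'I_m -> bool}) : set (m.-tuple T) :=
  [set z | exists2 S, A S & forall i, b i <-> S (tnth z i)].

Definition traces A m (z : m.-tuple T) : {set {ffun 'I_m -> bool}} :=
  finset (fun b => `[< realizes A b z >]).

(* The supremum of #|traces A z| over m distinct points z; all these
   cardinalities are at most 2 ^ m, so the maximum is attained. *)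
Definition shatter_coef A (m : nat) : nat :=
  \max_(k < (2 ^ m).+1 |
    `[< exists2 z : m.-tuple T, uniq z & #|traces A z| = k >]) k.

Definition has_vc_dim A (v : nat) : Prop :=
  [/\ (0 < v)%N, shatter_coef A v = (2 ^ v)%N &
      forall m, (0 < m)%N -> shatter_coef A m = (2 ^ m)%N -> (m <= v)%N].

End VC.

Definition universally_measurable (R : realType) (d : measure_display)
    (T : measurableType d) (E : set T) : Prop :=
  forall Q : probability T R, exists B1 B2 : set T,
    [/\ measurable B1, measurable B2, B1 `<=` E, E `<=` B2 &
        Q (B2 `\` B1) = 0].

(* Measurability of the class in the sense of empirical process theory.  It
   holds for every countable class, and for every image admissible Suslin
   class (the sets realizes A b are then analytic).  Without it the uniform
   deviation inequalities for VC classes are not theorems of ZFC: under the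
   continuum hypothesis the initial segments of a well-ordering of [0, 1] of
   type omega_1 are countable sets, form a class of dimension 1, and violate
   the uniform law of large numbers. *)
Definition permissible (R : realType) (d : measure_display)
    (T : measurableType d) (A : set (set T)) : Prop :=
  forall m (b : {ffun 'I_m -> bool}),
    @universally_measurable R _ (m.-tuple T) (realizes A b).

Section Probability.
Context {R : realType} {dO : measure_display} {Omega : measurableType dO}.
Variable P : probability Omega R.

(* The family is indexed by the whole of the finite type I and B i may be the
   full space, so the product rule below covers every subfamily. *)
Definition mutually_independent (I : finType) (dT : measure_display)
    (T : measurableType dT) (Z : I -> Omega -> T) : Prop :=
  forall B : I -> set T, (forall i, measurable (B i)) ->
    P [set w | forall i, B i (Z i w)] = \prod_(i : I) P (Z i @^-1` B i).

Definition identically_distributed (I : finType) (dT : measure_display)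
    (T : measurableType dT) (Z : I -> Omega -> T) : Prop :=
  forall (i j : I) (B : set T), measurable B ->
    P (Z i @^-1` B) = P (Z j @^-1` B).

(* h is a version of the regression function x |-> E[Z | X = x]. *)
Definition is_cond_exp (dT : measure_display) (T : measurableType dT)
    (X : Omega -> T) (Z : Omega -> R) (h : T -> R) : Prop :=
  [/\ P.-integrable setT (EFin \o Z), measurable_fun setT h,
      P.-integrable setT (fun w => (h (X w))%:E) &
      forall B, measurable B ->
        \int[P]_(w in X @^-1` B) (Z w)%:E =
        \int[P]_(w in X @^-1` B) (h (X w))%:E].

Definition cond_subgaussian (dT : measure_display) (T : measurableType dT)
    (X : Omega -> T) (eps : Omega -> R) (sigma : R) : Prop :=
  is_cond_exp X eps (cst 0%R) /\
  forall s : R, exists2 h : T -> R,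
    is_cond_exp X (fun w => expR (s * eps w)) h &
    {ae P, forall w, (h (X w) <= expR (s ^+ 2 * sigma ^+ 2 / 2))%R}.

End Probability.

Section LocalMaps.
Context {R : realType} {d n : nat} {Omega : Type}.
Local Notation Rd := (d.-tuple R).

(* The generic pair at index None, the i-th sample pair at index Some i. *)
Definition pairs (X : Omega -> Rd) (Y : Omega -> R)
    (Xs : 'I_n -> Omega -> Rd) (Ys : 'I_n -> Omega -> R)
    (o : option 'I_n) (w : Omega) : Rd * R :=
  if o is Some i then (Xs i w, Ys i w) else (X w, Y w).

Definition empirical (Xs : 'I_n -> Omega -> Rd) (w : Omega) (A : set Rd) : R :=
  ((\sum_(i < n) \1_A (Xs i w)) / n%:R)%R.

(* The convention 0 / 0 = 0 is that of division in R. *)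
Definition local_estimator (Xs : 'I_n -> Omega -> Rd) (Ys : 'I_n -> Omega -> R)
    (V : Omega -> Rd -> set Rd) (w : Omega) (x : Rd) : R :=
  ((\sum_(i < n) Ys i w * \1_(V w x) (Xs i w)) /
   (\sum_(i < n) \1_(V w x) (Xs i w)))%R.

(* A random local map on SX; its values outside SX are irrelevant.  It is an
   arbitrary function of the outcome, hence may depend on the sample and on
   additional randomness. *)
Definition local_map (SX : set Rd) (V : Omega -> Rd -> set Rd) : Prop :=
  forall w x, SX x -> [/\ measurable (V w x), V w x `<=` SX & V w x x].

End LocalMaps.

Definition large {R : realType} {d n : nat} {dO : measure_display}
    {Omega : measurableType dO} (P : probability Omega R)
    (SX : set (d.-tuple R)) (X : {RV P >-> d.-tuple R})
    (Xs : 'I_n -> Omega -> d.-tuple R)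
    (V : Omega -> d.-tuple R -> set (d.-tuple R)) (v : nat) (delta : R) : Prop :=
  {ae P, forall w, forall x, SX x ->
    (36 * ln (4 * (2 * n + 1)%:R ^+ v / delta) <=
     n%:R * Num.max (empirical Xs w (V w x))
                    (fine (distribution P X (V w x))))%R}.

(* sqrt (3 sigma^2 / (n l mu) * log ((n + 1)^v / delta)), where mu stands for
   the Lebesgue measure of a cell; fine +oo = 0 gives the value 0 = 1 / +oo
   when mu = +oo. *)
Definition noise_bound {R : realType} (n v : nat) (sigma delta l : R)
    (mu : \bar R) : \bar R :=
  if mu == 0 then +oo
  else (Num.sqrt (3 * sigma ^+ 2 / (n%:R * l * fine mu) *
                  ln ((n + 1)%:R ^+ v / delta)))%:E.

(* Main.v *)
(* Two uniform events carry the proof; both only involve the traces of the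
   class on finite samples, of which there are polynomially many.

   Noise: for a fixed trace b, a Chernoff bound on the event that b is a trace
   of the sample gives failure probability exp(- La) times the probability
   that b is a trace; summing over b costs the growth function once.

   Deviation (P_n >= 2/3 P on large cells): with a ghost sample, let N and N'
   be the numbers of points of a cell in the two samples and consider the sum
   over the traces of (4/5)^N (6/5)^N'.  Exchanging the i-th points of the two
   samples preserves their joint law, and (4/5 + 6/5) / 2 = 1, so its
   expectation is at most the growth function.  On the other hand a cell with
   n P >= 36 u and N < 2/3 n P makes the conditional expectation given the
   first sample at least (4/5)^N (6/5)^(n P) >= exp u, by Jensen's inequality.
   Markov's inequality then replaces the usual conditional-probability step
   of the symmetrization. *)

Require Import Defs.
From HB Require Import structures.
From mathcomp Require Import all_boot all_order all_algebra.
From mathcomp Require Import all_classical all_reals all_analysis.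
From mathcomp Require Import measurable_realfun.
From mathcomp Require Import ring lra zify.
Set Implicit Arguments.
Unset Strict Implicit.
Unset Printing Implicit Defensive.
Import Order.TTheory GRing.Theory Num.Theory.
Import numFieldNormedType.Exports.

(** * Polynomial growth of the number of traces of a VC class (Sauer-Shelah) *)

Section Sauer.
Import fintype finset.
Local Open Scope nat_scope.

Definition shattered (I : finType) (F : {set {set I}}) (S : {set I}) : bool :=
  [forall B : {set I}, (B \subset S) ==> [exists X in F, X :&: S == B]].

Lemma shatteredP (I : finType) (F : {set {set I}}) (S : {set I}) :
  reflect (forall B : {set I}, B \subset S ->
             exists2 X, X \in F & X :&: S = B)
          (shattered F S).
Proof.
apply: (iffP forallP) => [H B BS|H B].
  by have /implyP/(_ BS)/exists_inP[X XF /eqP XB] := H B; exists X.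
by apply/implyP => /H[X XF XB]; apply/exists_inP; exists X => //; apply/eqP.
Qed.

Lemma shatteredS (I : finType) (F G : {set {set I}}) (S : {set I}) :
  F \subset G -> shattered F S -> shattered G S.
Proof.
move=> /subsetP FG /shatteredP H; apply/shatteredP => B /H[X XF XB].
by exists X => //; exact: FG.
Qed.

(* Pajor's form of the Sauer-Shelah lemma: split F according to membership of
   a point x; a set S shattered by both halves is counted a second time as
   x |: S. *)
Lemma card_le_shattered (I : finType) (F : {set {set I}}) :
  #|F| <= #|[set S | shattered F S]|.
Proof.
have [k] := ubnP #|F|; elim: k F => // k IH F Fk.
have [F1|F2] := leqP #|F| 1.
  have [->|F0] := eqVneq F finset.set0; first by rewrite cards0.
  apply: (leq_trans F1); rewrite card_gt0; apply/set0Pn; exists finset.set0.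
  rewrite inE; apply/shatteredP => B; rewrite finset.subset0 => /eqP ->.
  by have /set0Pn[X XF] := F0; exists X => //; rewrite finset.setI0.
have [X [Y [XF YF XY]]] : exists X Y, [/\ X \in F, Y \in F & X != Y].
  by have /card_gt1P[X [Y []]] := F2; exists X, Y.
have [x xXY] : exists x, (x \in X) != (x \in Y).
  apply/existsP; apply: contraNT XY; rewrite negb_exists => /forallP H.
  by apply/eqP/setP => x; apply/eqP; rewrite -[_ == _]negbK H.
pose F0 := [set Z in F | x \notin Z]; pose F1 := [set Z in F | x \in Z].
have FE : #|F0| + #|F1| = #|F|.
  rewrite -(cardsID [set Z : {set I} | x \in Z] F) addnC; congr (_ + _).
    by apply: eq_card => Z; rewrite !inE.
  by apply: eq_card => Z; rewrite !inE andbC.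
have F0gt : 0 < #|F0| /\ 0 < #|F1|.
  move: xXY; case xX: (x \in X); case xY : (x \in Y) => // _.
    by split; apply/card_gt0P; [exists Y|exists X]; rewrite inE ?XF ?YF ?xX ?xY.
  by split; apply/card_gt0P; [exists X|exists Y]; rewrite inE ?XF ?YF ?xX ?xY.
have IH0 : #|F0| <= #|[set S | shattered F0 S]|.
  by apply: IH; case: F0gt Fk FE; lia.
have IH1 : #|F1| <= #|[set S | shattered F1 S]|.
  by apply: IH; case: F0gt Fk FE; lia.
set D0 := [set S | shattered F0 S] in IH0.
set D1 := [set S | shattered F1 S] in IH1.
have F0F : F0 \subset F by apply/subsetP => Z; rewrite inE => /andP[].
have F1F : F1 \subset F by apply/subsetP => Z; rewrite inE => /andP[].
(* Membership of [x] is constant on each half, so neither half shatters a set containing [x]: the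
   full trace fails for [F0], the empty trace for [F1]. *)
have xD0 S : S \in D0 -> x \notin S.
  rewrite inE => /shatteredP/(_ S (subxx _))[Z]; rewrite inE => /andP[_ xZ] <-.
  by rewrite inE (negbTE xZ).
have xD1 S : S \in D1 -> x \notin S.
  rewrite inE => /shatteredP/(_ finset.set0 (finset.sub0set _))[Z].
  rewrite inE => /andP[_ xZ] /setP/(_ x); rewrite !inE xZ /= => ->.
  by [].
pose D2 := [set x |: S | S in D0 :&: D1].
have D2E : #|D2| = #|D0 :&: D1|.
  apply: card_in_imset => S S'; rewrite !finset.in_setI => /andP[/xD0 xS _].
  move=> /andP[/xD0 xS' _] /(congr1 (fun U => U :\ x)).
  by rewrite !finset.setU1K.
have D2disj : [disjoint D0 :|: D1 & D2].
  rewrite -finset.setI_eq0; apply/eqP/setP => S; rewrite !inE; apply/negP.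
  case/andP => S01 /imsetP[S' _ SE].
  have : x \in S by rewrite SE !inE eqxx.
  by apply/negP; case/orP: S01 => sS; [apply: xD0|apply: xD1]; rewrite inE.
have sub : (D0 :|: D1) :|: D2 \subset [set S | shattered F S].
  apply/subsetP => S; rewrite finset.in_setU => /orP[|].
    by rewrite !inE => /orP[] /shatteredS; apply.
  move=> /imsetP[S']; rewrite finset.in_setI => /andP[S'0 S'1] ->.
  have xS' := xD0 _ S'0.
  move: S'0 S'1; rewrite !inE => /shatteredP H0 /shatteredP H1.
  apply/shatteredP => B Bsub.
  have BxS : B :\ x \subset S'.
    by rewrite finset.subDset.
  (* A trace on [x |: S'] containing [x] is cut out by a member of [F1], the others by a member of
     [F0]. *)
  have [xB|xB] := boolP (x \in B).
    have [Z] := H1 _ BxS; rewrite inE => /andP[ZF xZ] ZE; exists Z => //.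
    rewrite finset.setIUr ZE; apply/setP => y; rewrite !inE.
    by have [->|] := eqVneq y x; rewrite ?xZ ?xB ?andbF.
  have [Z] := H0 _ BxS; rewrite inE => /andP[ZF xZ] ZE; exists Z => //.
  rewrite finset.setIUr ZE; apply/setP => y; rewrite !inE.
  by have [->|] := eqVneq y x; rewrite ?(negbTE xZ) ?(negbTE xB) ?andbF.
rewrite -FE; apply: (leq_trans _ (subset_leq_card sub)).
rewrite cardsU (disjoint_setI0 D2disj) cards0 subn0 D2E.
have := cardsUI D0 D1; lia.
Qed.

(** A set with at most [v] elements is listed in [v] slots, each holding an element of [I] or left
    blank; there are [(#|I| + 1) ^ v] such listings. *)
Lemma card_small_sets (I : finType) v :
  #|[set S : {set I} | #|S| <= v]| <= #|I|.+1 ^ v.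
Proof.
pose f (t : {ffun 'I_v -> option I}) : {set I} :=
  [set i | [exists j, t j == Some i]].
have -> : #|I|.+1 ^ v = #|{: {ffun 'I_v -> option I}}|.
  by rewrite card_ffun card_ord card_option.
rewrite -cardsT; apply: leq_trans (leq_imset_card f _).
apply: subset_leq_card; apply/subsetP => S; rewrite inE => Sv.
apply/imsetP; exists [ffun j : 'I_v => nth None (map Some (enum S)) j] => //.
apply/setP => i; rewrite inE; apply/idP/existsP => [iS|[j]].
  have iE : index i (enum S) < #|S| by rewrite cardE index_mem mem_enum.
  exists (Ordinal (leq_trans iE Sv)); rewrite ffunE /=.
  by rewrite (nth_map i) -?cardE// nth_index ?mem_enum.
rewrite ffunE; have [jS|jS] := ltnP j (size (enum S)); last first.
  by rewrite nth_default ?size_map.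
by rewrite (nth_map i)// => /eqP[<-]; rewrite -mem_enum mem_nth.
Qed.

(** Traces are read as sets of indices. Indices shattered by the traces index points shattered by
    [A], so there are at most [v] of them, and the traces are no more numerous than the index sets
    of size at most [v]. *)
Lemma card_traces (T : eqType) (A : set (set T)) v m (z : m.-tuple T) :
  has_vc_dim A v -> #|traces A z| <= m.+1 ^ v.
Proof.
case=> v0 vv vmax.
pose supp (b : {ffun 'I_m -> bool}) : {set 'I_m} := [set i | b i].
have supp_inj : injective supp.
  by move=> b b' /setP bb; apply/ffunP => i; have := bb i; rewrite !inE.
pose F := supp @: traces A z.
rewrite -(card_imset _ supp_inj) -/F.
apply: (leq_trans (card_le_shattered F)).
rewrite -[X in X.+1](card_ord m); apply: leq_trans (card_small_sets _ v).
apply: subset_leq_card; apply/subsetP => S; rewrite !inE => /shatteredP shS.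
have [->//|S0] := posnP #|S|.
have rlz (B : {set 'I_m}) : B \subset S ->
    exists2 C, A C & forall i, i \in S -> (i \in B) <-> C (tnth z i).
  move=> /shS[X /imsetP[b]]; rewrite inE => /asboolP[C AC bC] -> BE.
  exists C => // i iS; rewrite -bC.
  by have /setP/(_ i) := BE; rewrite !inE iS andbT => <-.
apply: (vmax _ S0).
have i0 : 'I_m by move: S0; rewrite cardE; case: (enum S).
pose e := [tuple of map (tnth z) (enum_tuple S)].
have enE (i : 'I_#|S|) : tnth e i = tnth z (tnth (enum_tuple S) i).
  by rewrite tnth_map.
have eS (i : 'I_#|S|) : tnth (enum_tuple S) i \in S.
  by rewrite -mem_enum; exact: mem_tnth.
(* The sample may repeat points, but shattered indices carry distinct ones: the trace [[set i]]
   separates [i] from every other index of [S]. *)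
have ue : uniq e.
  rewrite map_inj_in_uniq ?enum_uniq// => i j; rewrite !mem_enum => iS jS ij.
  have [|C _ iC] := rlz [set i]; first by rewrite finset.sub1set.
  have : C (tnth z j) by rewrite -ij; apply/(iC i iS); rewrite inE.
  by move/(iC j jS); rewrite inE => /eqP ->.
have te : #|traces A e| = 2 ^ #|S|.
  rewrite -[in RHS]card_bool -[X in _ = _ ^ X]card_ord -card_ffun -cardsT.
  congr #|pred_of_set _|; apply/setP => b; rewrite !inE; apply/asboolP.
  pose B := [set tnth (enum_tuple S) i | i : 'I_#|S| & b i].
  have [|C AC BC] := rlz B.
    by apply/subsetP => j /imsetP[i _ ->].
  exists C => // i; rewrite enE -BC//; split=> [bi|/imsetP[j]].
    by apply/imsetP; exists i => //; rewrite inE.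
  rewrite inE => bj; rewrite !(tnth_nth i0) => /eqP.
  by rewrite nth_uniq ?enum_uniq// -?cardE// => /eqP /val_inj ->.
apply/eqP; rewrite eqn_leq; apply/andP; split.
  by apply/bigmax_leqP => k _; rewrite -ltnS.
have kS : 2 ^ #|S| < (2 ^ #|S|).+1 by [].
apply: (@bigop.bigmax_sup _ (Ordinal kS)) => //.
by apply/asboolP; exists e.
Qed.

End Sauer.

Local Open Scope classical_set_scope.
Local Open Scope ring_scope.
Local Open Scope ereal_scope.

(** * Joint laws of independent samples *)

Section ProductLaw.
Context {R : realType} {dT : measure_display} {T : measurableType dT}.

Definition has_product_law {dO : measure_display} {Omega : measurableType dO}
    (P : probability Omega R) (m : nat) (Z : 'I_m -> Omega -> T)
    (mu : set T -> \bar R) :=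
  forall B : 'I_m -> set T, (forall i, measurable (B i)) ->
    P [set w | forall i, B i (Z i w)] = \prod_(i < m) mu (B i).

Lemma measurable_mktuple {dO : measure_display} {Omega : measurableType dO}
    m (Z : 'I_m -> Omega -> T) :
  (forall i, measurable_fun setT (Z i)) ->
  measurable_fun setT (fun w => [tuple Z i w | i < m]).
Proof.
move=> mZ; apply/measurable_fun_tnthP => i.
by rewrite (_ : _ \o _ = Z i)//; apply/funext => w /=; rewrite tnth_mktuple.
Qed.

Lemma measurable_rectangle m (B : 'I_m -> set T) :
  (forall i, measurable (B i)) ->
  measurable [set z : m.-tuple T | forall i, B i (tnth z i)].
Proof.
move=> mB.
rewrite (_ : [set _ | _] =
    \big[setI/setT]_(i < m) ((@tnth m T)^~ i @^-1` B i)); last first.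
  rewrite -bigcap_seq; apply/seteqP; split => z /= Bz i.
    by move=> _; exact: Bz.
  by apply: Bz => /=; rewrite mem_index_enum.
apply: bigsetI_measurable => i _.
by rewrite -[X in measurable X]setTI; exact: measurable_tnth.
Qed.

(** Rectangles are stable under intersection and generate the product sigma-algebra, so they
    determine a probability. *)
Lemma eq_probability_rectangle m (Q1 Q2 : probability (m.-tuple T) R) :
  (forall B : 'I_m -> set T, (forall i, measurable (B i)) ->
     Q1 [set z | forall i, B i (tnth z i)] =
     Q2 [set z | forall i, B i (tnth z i)]) ->
  forall C, measurable C -> Q1 C = Q2 C.
Proof.
move=> Q12 C mC.
pose G : set (set (m.-tuple T)) :=
  [set [set z | forall i, B i (tnth z i)] | B in
    [set B : 'I_m -> set T | forall i, measurable (B i)]].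
have GT : G setT.
  by exists (fun=> setT) => //=; apply/seteqP; split.
apply: (measure_unique G (fun=> setT)) => //.
- apply/seteqP; split.
    apply: smallest_sub; first exact: smallest_sigma_algebra.
    move=> D; rewrite -bigcup_seq => -[i _ [E mE <-]]; apply: sub_sigma_algebra.
    exists (fun j => if j == i then E else setT) => /=.
      by move=> j; case: ifP.
    apply/seteqP; split => [z /(_ i)|z [_ Ez] j]; first by rewrite eqxx.
    by case: eqP => // ->.
  apply: smallest_sub; first exact: sigma_algebra_measurable.
  by move=> _ [B mB <-]; exact: measurable_rectangle.
- move=> _ _ [B mB <-] [B' mB' <-]; exists (fun i => B i `&` B' i).
    by move=> i; exact: measurableI.
  apply/seteqP; split => z; first by move=> BB'; split=> i; case: (BB' i).
  by move=> [Bz B'z] i; split.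
- by apply/seteqP; split => // z _; exists 0%N.
- by move=> _ [B mB <-]; exact: Q12.
- by move=> k /=; rewrite probability_setT ltry.
Qed.

Context {d1 d2 : measure_display} {O1 : measurableType d1}
  {O2 : measurableType d2} (P1 : probability O1 R) (P2 : probability O2 R).

(** The two samples may live on different spaces; this and its integral form justify every exchange
    and every resampling of points below. *)
Lemma has_product_law_probability m (Z1 : 'I_m -> O1 -> T)
    (Z2 : 'I_m -> O2 -> T) (mu : set T -> \bar R) :
  (forall i, measurable_fun setT (Z1 i)) ->
  (forall i, measurable_fun setT (Z2 i)) ->
  has_product_law P1 Z1 mu -> has_product_law P2 Z2 mu ->
  forall C, measurable C ->
  P1 [set w | C [tuple Z1 i w | i < m]] = P2 [set w | C [tuple Z2 i w | i < m]].
Proof.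
move=> /measurable_mktuple mZ1 /measurable_mktuple mZ2 Z1mu Z2mu.
pose f1 : {mfun O1 >-> m.-tuple T} := mfun_Sub (mem_set mZ1).
pose f2 : {mfun O2 >-> m.-tuple T} := mfun_Sub (mem_set mZ2).
move=> C mC.
apply: (@eq_probability_rectangle m
  (distribution P1 f1) (distribution P2 f2)) => //.
move=> B mB; transitivity (\prod_(i < m) mu (B i)).
  rewrite -(Z1mu B mB); congr (P1 _); apply/seteqP.
  by split=> w /= Bw i; have := Bw i; rewrite tnth_mktuple.
rewrite -(Z2mu B mB); congr (P2 _); apply/seteqP.
by split=> w /= Bw i; have := Bw i; rewrite tnth_mktuple.
Qed.

Lemma has_product_law_integral m (Z1 : 'I_m -> O1 -> T)
    (Z2 : 'I_m -> O2 -> T) (mu : set T -> \bar R) (f : m.-tuple T -> \bar R) :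
  (forall i, measurable_fun setT (Z1 i)) ->
  (forall i, measurable_fun setT (Z2 i)) ->
  has_product_law P1 Z1 mu -> has_product_law P2 Z2 mu ->
  measurable_fun [set: m.-tuple T] f -> (forall z, 0 <= f z) ->
  \int[P1]_w f [tuple Z1 i w | i < m] = \int[P2]_w f [tuple Z2 i w | i < m].
Proof.
move=> mZ1 mZ2 Z1mu Z2mu mf f0.
have mt1 := measurable_mktuple mZ1; have mt2 := measurable_mktuple mZ2.
pose f1 : {mfun O1 >-> m.-tuple T} := mfun_Sub (mem_set mt1).
pose f2 : {mfun O2 >-> m.-tuple T} := mfun_Sub (mem_set mt2).
transitivity (\int[distribution P1 f1]_z f z).
  by rewrite ge0_integral_distribution.
transitivity (\int[distribution P2 f2]_z f z); last first.
  by rewrite ge0_integral_distribution.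
apply: eq_measure_integral => C mC _.
exact: (has_product_law_probability mZ1 mZ2 Z1mu Z2mu).
Qed.

End ProductLaw.

(** * Measurable approximation of the trace events *)

Section Hulls.
Context {R : realType} {dT : measure_display} {T : measurableType dT}.
Variable A : set (set T).

(* The traces of A are only universally measurable: L and H are measurable
   inner and outer approximations of equal probability. *)
Definition realizes_hull m (Q : probability (m.-tuple T) R)
    (L H : {ffun 'I_m -> bool} -> set (m.-tuple T)) :=
  forall b, [/\ measurable (L b), measurable (H b),
    L b `<=` realizes A b, realizes A b `<=` H b & Q (H b) = Q (L b)].

Lemma permissible_hull m (Q : probability (m.-tuple T) R) :
  permissible R A -> exists L H, realizes_hull Q L H.
Proof.
move=> pA.
have /choice[LH LHP] : forall b : {ffun 'I_m -> bool},
    exists LH : set (m.-tuple T) * set (m.-tuple T),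
    [/\ measurable LH.1, measurable LH.2,
    LH.1 `<=` realizes A b, realizes A b `<=` LH.2 & Q LH.2 = Q LH.1].
  move=> b; have [B1 [B2 [mB1 mB2 B1b bB2 QB]]] := pA m b Q.
  exists (B1, B2); split => //=.
  have B12 : B1 `<=` B2 by exact: subset_trans bB2.
  rewrite -(setDUK B12) measureU ?setDIK//; last exact: measurableD.
  by rewrite [X in _ + X]QB adde0.
by exists (fst \o LH), (snd \o LH) => b; exact: LHP.
Qed.

(** The sum is an expected number of traces. Passing from [H b] to [L b] keeps the probabilities and
    ensures that a point lies in [L b] only if [b] is truly one of its at most [K] traces. *)
Lemma sum_hull_le m (Q : probability (m.-tuple T) R) L H (K : nat) :
  realizes_hull Q L H -> (forall z : m.-tuple T, (#|traces A z| <= K)%N) ->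
  \sum_b Q (H b) <= K%:R%:E.
Proof.
move=> LH trK.
have mL b : measurable (L b) by have [] := LH b.
rewrite (eq_bigr (fun b => \int[Q]_z (\1_(L b) z)%:E)); last first.
  by move=> b _; rewrite integral_indic// setIT; have [] := LH b.
rewrite -ge0_integral_sum//; last first.
  by move=> b; apply/measurable_EFinP; exact: measurable_indic.
rewrite -[leRHS]mule1 -(probability_setT Q) -integral_cst//.
apply: ge0_le_integral => //.
- by move=> z _; apply: sume_ge0 => b _; rewrite lee_fin.
- apply: emeasurable_sum => b.
  by apply/measurable_EFinP; exact: measurable_indic.
- move=> z _; rewrite sumEFin lee_fin.
  apply: (@le_trans _ _ (\sum_(b in traces A z) 1)%R); last first.
    by rewrite sumr_const ler_nat.
  rewrite [leRHS]big_mkcond/=; apply: ler_sum => b _.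
  rewrite indicE; case: ifPn; first by move=> _; rewrite lern1 leq_b1.
  rewrite inE => /asboolPn nbz; rewrite memNset// => Lbz; apply: nbz.
  by have [_ _ /(_ _ Lbz)] := LH b.
Qed.

(** If the permuted sample realizes [b], the sample realizes [b] composed with [s]. This sends [L b]
    into the outer set of the permuted labelling; since [s] is an involution, one inequality gives
    both. *)
Lemma hull_perm m (Q : probability (m.-tuple T) R) L H (s : 'I_m -> 'I_m) :
  realizes_hull Q L H -> involutive s ->
  (forall C, measurable C ->
     Q [set z | C [tuple tnth z (s i) | i < m]] = Q C) ->
  forall b : {ffun 'I_m -> bool}, Q (H [ffun i => b (s i)]) = Q (H b).
Proof.
move=> LH ss Qs.
suff le (b : {ffun 'I_m -> bool}) : Q (H b) <= Q (H [ffun i => b (s i)]).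
  move=> b; apply/eqP; rewrite eq_le le andbT.
  rewrite [in leRHS](_ : b = [ffun i => [ffun j => b (s j)] (s i)])//.
  by apply/ffunP => i; rewrite !ffunE ss.
have [mL _ Lb _ ->] := LH b.
rewrite -Qs//.
have [_ mH _ bH _] := LH [ffun i => b (s i)].
have mp : measurable_fun [set: m.-tuple T]
    (fun z => [tuple tnth z (s i) | i < m]).
  by apply: measurable_mktuple => i; exact: measurable_tnth.
rewrite le_measure ?inE//.
  by rewrite -[X in measurable X]setTI; exact: mp.
move=> z /Lb[S AS bS]; apply: bH; exists S => // i.
by rewrite ffunE bS tnth_mktuple ss.
Qed.

End Hulls.

(** * The ghost sample and the exchange of paired points *)

Section Ghost.
Context {R : realType} {dT : measure_display} {T : measurableType dT}.

Lemma product_law_perm {dO : measure_display} {Omega : measurableType dO}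
    (P : probability Omega R) m (Z : 'I_m -> Omega -> T) (mu : set T -> \bar R)
    (s : 'I_m -> 'I_m) : involutive s ->
  has_product_law P Z mu -> has_product_law P (fun i => Z (s i)) mu.
Proof.
move=> ss Zmu B mB.
rewrite (reindex_inj (inv_inj ss))/= -(Zmu (fun i => B (s i)))//.
congr (P _); apply/seteqP; split => w /= Bw i; have := Bw (s i); rewrite ss//.
Qed.

Lemma product_law_marginal {dO : measure_display} {Omega : measurableType dO}
    (P : probability Omega R) m (Z : 'I_m -> Omega -> T)
    (mu : probability T R) (i : 'I_m) (C : set T) :
  has_product_law P Z mu -> measurable C -> P (Z i @^-1` C) = mu C.
Proof.
move=> Zmu mC; pose B j := if j == i then C else setT.
have mB j : measurable (B j) by rewrite /B; case: ifP.
rewrite (_ : _ @^-1` _ = [set w | forall j, B j (Z j w)]); last first.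
  apply/seteqP; split => [w Cw j|w /(_ i)]; rewrite /B ?eqxx//.
  by case: eqP => // ->.
rewrite Zmu// (bigD1 i)//= big1 ?mule1 ?[in LHS]/B ?eqxx// => j ji.
by rewrite /B (negbTE ji) probability_setT.
Qed.

(** The independent copy is obtained by evaluating the same variables on a second factor [Omega]:
    indices below [n] read the first factor, the others the second. *)
Definition ghost {Omega : Type} n (Z : 'I_n -> Omega -> T) (k : 'I_(n + n))
    (w : Omega * Omega) : T :=
  match fintype.split k with inl i => Z i w.1 | inr i => Z i w.2 end.

Definition swap n (i : 'I_n) (k : 'I_(n + n)) : 'I_(n + n) :=
  match fintype.split k with
  | inl j => if j == i then rshift n j else k
  | inr j => if j == i then lshift n j else k
  end.

Lemma swap_lshift n (i j : 'I_n) :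
  swap i (lshift n j) = if j == i then rshift n j else lshift n j.
Proof. by rewrite /swap (unsplitK (inl _ j)). Qed.

Lemma swap_rshift n (i j : 'I_n) :
  swap i (rshift n j) = if j == i then lshift n j else rshift n j.
Proof. by rewrite /swap (unsplitK (inr _ j)). Qed.

Lemma swapK n (i : 'I_n) : involutive (swap i).
Proof.
move=> k; rewrite -(splitK k); case: (fintype.split k) => j /=.
  rewrite swap_lshift; case: ifPn => ji; first by rewrite swap_rshift ji.
  by rewrite swap_lshift (negbTE ji).
rewrite swap_rshift; case: ifPn => ji; first by rewrite swap_lshift ji.
by rewrite swap_rshift (negbTE ji).
Qed.

Lemma measurable_ghost {dO : measure_display} {Omega : measurableType dO} n
    (Z : 'I_n -> Omega -> T) k :
  (forall i, measurable_fun setT (Z i)) -> measurable_fun setT (ghost Z k).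
Proof.
move=> mZ; rewrite /ghost; case: (fintype.split k) => i.
  exact: (measurableT_comp (mZ i) measurable_fst).
exact: (measurableT_comp (mZ i) measurable_snd).
Qed.

Lemma ghost_law {dO : measure_display} {Omega : measurableType dO}
    (P : probability Omega R) n (Z : 'I_n -> Omega -> T) (mu : set T -> \bar R) :
  (forall i, measurable_fun setT (Z i)) ->
  has_product_law P Z mu -> has_product_law (P \x P) (ghost Z) mu.
Proof.
move=> mZ Zmu B mB.
have mrect (C : 'I_n -> set T) : (forall i, measurable (C i)) ->
    measurable [set w | forall i, C i (Z i w)].
  move=> mC; have := measurable_mktuple mZ measurableT (measurable_rectangle mC).
  rewrite setTI; congr measurable; apply/seteqP.
  by split => w /= Cw i; have := Cw i; rewrite tnth_mktuple.
rewrite big_split_ord/= -(Zmu (fun i => B (lshift n i)))//.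
rewrite -(Zmu (fun i => B (rshift n i)))// -product_measure1E; last 2 first.
- exact: (mrect (fun i => B (lshift n i))).
- exact: (mrect (fun i => B (rshift n i))).
congr product_measure1; apply/seteqP; split => -[w1 w2] /=.
  move=> Bw; split => i.
    by have := Bw (lshift n i); rewrite /ghost (unsplitK (inl _ i)).
  by have := Bw (rshift n i); rewrite /ghost (unsplitK (inr _ i)).
move=> [Bw1 Bw2] k; rewrite /ghost -[k in B k]splitK.
by case: (fintype.split k) => i /=; [exact: Bw1|exact: Bw2].
Qed.

End Ghost.

(** * Symmetrization as a finite weighted sum over labellings *)

Section SwapSum.
Local Open Scope ring_scope.
Context {R : realType}.

(** The factors are removed one index at a time. Swapping the pair [i] preserves [q] and the other
    factors, so the [i]-th factor may be replaced by the mean of [phi x y] and [phi y x], which is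
    at most 1. *)
Lemma sum_swap_le n (q : {ffun 'I_(n + n) -> bool} -> R)
    (phi : bool -> bool -> R) :
  (forall b, 0 <= q b) ->
  (forall (i : 'I_n) (b : {ffun 'I_(n + n) -> bool}),
     q [ffun k => b (swap i k)] = q b) ->
  (forall x y, 0 <= phi x y) -> (forall x y, phi x y + phi y x <= 2) ->
  \sum_b q b * \prod_(i < n) phi (b (lshift n i)) (b (rshift n i)) <=
  \sum_b q b.
Proof.
move=> q0 qs phi0 phi2.
have : uniq (index_enum 'I_n) by exact: index_enum_uniq.
elim: (index_enum 'I_n) => [_|i r IH /= /andP[ir ur]].
  by apply: ler_sum => b _; rewrite big_nil mulr1.
apply: le_trans (IH ur) => {IH}.
set W := fun b : {ffun 'I_(n + n) -> bool} =>
  \prod_(i <- r) phi (b (lshift n i)) (b (rshift n i)).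
set F := fun b : {ffun 'I_(n + n) -> bool} =>
  phi (b (lshift n i)) (b (rshift n i)).
set F' := fun b : {ffun 'I_(n + n) -> bool} =>
  phi (b (rshift n i)) (b (lshift n i)).
have W0 b : 0 <= W b by apply: prodr_ge0.
under eq_bigr do rewrite big_cons -/(F _) -/(W _).
pose sb (b : {ffun 'I_(n + n) -> bool}) := [ffun k => b (swap i k)].
have sbK : involutive sb by move=> b; apply/ffunP => k; rewrite !ffunE swapK.
have E : \sum_b q b * (F b * W b) = \sum_b q b * (F' b * W b).
  rewrite (reindex_inj (inv_inj sbK)); apply: eq_bigr => b _ /=.
  rewrite qs; congr (_ * (_ * _)).
    by rewrite /F /F' !ffunE swap_lshift swap_rshift eqxx.
  rewrite /W [LHS]big_seq [RHS]big_seq; apply: eq_bigr => j jr.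
  rewrite !ffunE swap_lshift swap_rshift.
  by have [ji|//] := eqVneq j i; rewrite -ji jr in ir.
rewrite -(ler_pM2l (ltr0Sn R 1)) mulr_natl mulr2n {2}E -big_split/= mulr_sumr.
apply: ler_sum => b _; rewrite -mulrDr mulrCA ler_wpM2l// -mulrDl.
by rewrite ler_wpM2r// phi2.
Qed.

End SwapSum.

(** * Empirical mass against true mass, uniformly over large cells *)

Section Deviation.
Context {R : realType} {dT : measure_display} {T : measurableType dT}.

Definition count_in {Omega : Type} n (Z : 'I_n -> Omega -> T) (w : Omega)
    (S : set T) : R := (\sum_(i < n) \1_S (Z i w))%R.

(* Chosen so that expR al + expR ga = 2 and al + 2/3 * ga >= 1/36. *)
Let al : R := ln (6 / 5).
Let ga : R := ln (4 / 5).

Let expR_al : expR al = (6 / 5)%R.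
Proof. by rewrite lnK// posrE; lra. Qed.

Let expR_ga : expR ga = (4 / 5)%R.
Proof. by rewrite lnK// posrE; lra. Qed.

Let ga_le0 : (ga <= 0)%R.
Proof. by apply: ln_le0; lra. Qed.

Let al_ge0 : (0 <= al)%R.
Proof. by apply: ln_ge0; lra. Qed.

(** Multiplying by 3 makes the exponents integers: [(6/5)^3 * (4/5)^2 = 3456/3125] exceeds [12/11],
    while [expR (1/12) <= 1 / (1 - 1/12) = 12/11]. *)
Let al_ga : (1 / 36 <= al + 2 / 3 * ga)%R.
Proof.
suff : (1 / 12 <= 3 * al + 2 * ga)%R by lra.
rewrite -ler_expR expRD !expRM_natl expR_al expR_ga.
have : (1 - 1 / 12 <= expR (- (1 / 12) : R))%R by exact: expR_ge1Dx.
have := expRxMexpNx_1 (1 / 12 : R); have := expR_gt0 (1 / 12 : R).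
by set x := expR (1 / 12); set y := expR _ => x0 xy y11; nra.
Qed.

(** The factor contributed by one pair of points: [x] tells whether the sample point lies in the
    cell, [y] whether its ghost does. *)
Let wt (x y : bool) : R :=
  ((if x then 4 / 5 else 1) * (if y then 6 / 5 else 1))%R.

Let wt_ge0 x y : (0 <= wt x y)%R.
Proof. by rewrite /wt; case: x; case: y; lra. Qed.

Let wt_swap x y : (wt x y + wt y x <= 2)%R.
Proof. by rewrite /wt; case: x; case: y; lra. Qed.

Let wtE x y : wt x y = expR (ga * x%:R + al * y%:R).
Proof.
rewrite /wt expRD; congr (_ * _)%R.
  by case: x; rewrite (mulr1, mulr0) ?expR0.
by case: y; rewrite (mulr1, mulr0) ?expR0.
Qed.

Context {dO : measure_display} {Omega : measurableType dO}.
Variable P : probability Omega R.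
Variables (n : nat) (Z : 'I_n -> Omega -> T) (mu : probability T R).
Hypothesis mZ : forall i, measurable_fun setT (Z i).
Hypothesis Zmu : has_product_law P Z mu.

Let measurable_count S : measurable S ->
  measurable_fun setT (fun w => count_in Z w S).
Proof.
move=> mS; apply: measurable_sum => i.
by apply: measurableT_comp => //; exact: measurable_indic.
Qed.

Let count_ge0 w S : (0 <= count_in Z w S)%R.
Proof. by apply: sumr_ge0 => i _; rewrite indicE. Qed.

Let mean_count S : measurable S ->
  \int[P]_w (count_in Z w S)%:E = n%:R%:E * mu S.
Proof.
move=> mS; rewrite /count_in; under eq_integral do rewrite -sumEFin.
rewrite ge0_integral_sum//; last first.
  move=> i; apply/measurable_EFinP.
  by apply: measurableT_comp => //; exact: measurable_indic.
rewrite (eq_bigr (fun=> mu S)); last first.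
  move=> i _; rewrite -(product_law_marginal i Zmu mS).
  rewrite -[in RHS](setIT (_ @^-1` _)) -integral_indic//.
  by rewrite -[X in measurable X]setTI; exact: mZ.
by rewrite sumr_const card_ord mule_natl.
Qed.

(** Jensen's inequality by integrating the tangent line of the exponential at the mean [m]. The term
    [C * al * m] is added to both sides to keep the integrands nonnegative. *)
Let mgf_count S : measurable S ->
  (expR (al * (n%:R * fine (mu S))))%:E <=
  \int[P]_w (expR (al * count_in Z w S))%:E.
Proof.
move=> mS; set m : R := (n%:R * fine (mu S))%R.
set C := expR (al * m); set N := fun w => count_in Z w S.
have C0 : (0 <= C)%R by exact: expR_ge0.
have m0 : (0 <= m)%R by rewrite mulr_ge0// fine_ge0.
have mN : measurable_fun setT N by exact: measurable_count.
have me : measurable_fun setT (fun w => (expR (al * N w))%:E).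
  apply/measurable_EFinP; apply: measurableT_comp => //.
  exact: measurable_funM.
have EN : \int[P]_w (N w)%:E = m%:E.
  by rewrite mean_count// /m EFinM fineK// fin_num_measure.
have E1 : \int[P]_w (C + C * al * N w)%:E = (C + C * al * m)%:E.
  under eq_integral do rewrite EFinD [X in _ + X]EFinM.
  rewrite ge0_integralD//; last 2 first.
  - by move=> w _; rewrite -EFinM lee_fin !mulr_ge0// count_ge0.
  - by apply/measurable_EFinP; apply: measurable_funM.
  rewrite integral_cst// [X in _ * X + _]probability_setT mule1.
  rewrite ge0_integralZl_EFin//; last 3 first.
  - by move=> w _; rewrite lee_fin count_ge0.
  - exact/measurable_EFinP.
  - by rewrite mulr_ge0.
  by rewrite EN -EFinM -EFinD.
have E2 : \int[P]_w (expR (al * N w) + C * al * m)%:E =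
    \int[P]_w (expR (al * N w))%:E + (C * al * m)%:E.
  under eq_integral do rewrite EFinD.
  rewrite ge0_integralD//; last first.
    by move=> w _; rewrite lee_fin mulr_ge0// mulr_ge0.
  by rewrite integral_cst// [X in _ + _ * X]probability_setT mule1.
rewrite -(@leeD2rE _ (C * al * m)%:E)// -E2 -EFinD -E1.
apply: ge0_le_integral => //.
- by move=> w _; rewrite lee_fin addr_ge0// !mulr_ge0// count_ge0.
- by apply/measurable_EFinP; apply: measurable_funD => //;
  exact: measurable_funM.
- apply/measurable_EFinP; apply: measurable_funD => //.
  by apply: measurableT_comp => //; exact: measurable_funM.
- move=> w _; rewrite lee_fin.
  have -> : expR (al * N w) = (C * expR (al * (N w - m)))%R.
    by rewrite /C -expRD -mulrDr addrC subrK.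
  have := ler_wpM2l C0 (expR_ge1Dx (al * (N w - m))); lra.
Qed.

Lemma relative_deviation (A : set (set T)) (v : nat) (u : R) :
  has_vc_dim A v -> permissible R A ->
  exists D : set Omega, [/\ measurable D,
    P D <= (((n + n).+1 ^ v)%:R * expR (- u))%:E &
    forall w, ~ D w -> forall S, A S -> measurable S ->
      (36 * u <= n%:R * fine (mu S))%R ->
      (2 / 3 * (n%:R * fine (mu S)) <= count_in Z w S)%R].
Proof.
move=> hvc hmeas.
have mG k : measurable_fun setT (ghost Z k) by exact: measurable_ghost.
have mtG := measurable_mktuple mG.
have Gmu := ghost_law mZ Zmu.
pose tG : {mfun (Omega * Omega)%type >-> (n + n).-tuple T} :=
  mfun_Sub (mem_set mtG).
pose Q : probability ((n + n).-tuple T) R := distribution (P \x P) tG.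
have [L [H LH]] := permissible_hull Q hmeas.
have mH b : measurable (H b) by have [] := LH b.
pose W (b : {ffun 'I_(n + n) -> bool}) : R :=
  (\prod_(i < n) wt (b (lshift n i)) (b (rshift n i)))%R.
have W0 b : (0 <= W b)%R by exact: prodr_ge0.
(* The sum runs over outer approximations: it is measurable and dominates the weight of every
   realized trace. *)
pose G (ww : Omega * Omega) : \bar R :=
  \sum_b (\1_(H b) (tG ww) * W b)%:E.
have mGb b : measurable_fun setT (fun ww => (\1_(H b) (tG ww) * W b)%:E).
  apply/measurable_EFinP; apply: measurable_funM => //.
  by apply: measurableT_comp => //; exact: measurable_indic.
have mGG : measurable_fun setT G by exact: emeasurable_sum.
have G0 ww : 0 <= G ww.
  by apply: sume_ge0 => b _; rewrite lee_fin mulr_ge0.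
have intG : \int[P \x P]_ww G ww <= ((n + n).+1 ^ v)%:R%:E.
  rewrite ge0_integral_sum//; last first.
    by move=> b ww _; rewrite lee_fin mulr_ge0.
  rewrite (eq_bigr (fun b => (fine (Q (H b)) * W b)%:E)); last first.
    move=> b _; under eq_integral do rewrite EFinM.
    rewrite ge0_integralZr//; last 2 first.
    - apply/measurable_EFinP.
      by apply: measurableT_comp => //; exact: measurable_indic.
    - by rewrite lee_fin.
    rewrite EFinM; congr (_ * _); rewrite fineK ?fin_num_measure//.
    have <- : \int[Q]_z (\1_(H b) z)%:E = Q (H b).
      by rewrite integral_indic// setIT.
    rewrite ge0_integral_distribution//.
    by apply/measurable_EFinP; exact: measurable_indic.
  apply: (@le_trans _ _ (\sum_b Q (H b))); last first.
    by apply: sum_hull_le LH _ => z; exact: card_traces.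
  rewrite (eq_bigr (fun b => (fine (Q (H b)))%:E)
    (F1 := fun b => Q (H b))); last first.
    by move=> b _; rewrite fineK// fin_num_measure.
  (* The weights average out because [Q (H b)] is invariant under swaps, the law of the doubled
     sample being so. *)
  rewrite !sumEFin lee_fin; apply: sum_swap_le => //.
    by move=> b; rewrite fine_ge0.
  move=> i b; congr fine; apply: (hull_perm LH (swapK i)) => C mC.
  have Gsmu := product_law_perm (swapK i) Gmu.
  have mGs k : measurable_fun setT (ghost Z (swap i k)) by [].
  rewrite -[RHS](has_product_law_probability mGs mG Gsmu Gmu mC).
  congr ((P \x P) _); apply/seteqP; split => ww /=;
    by congr C; apply: eq_from_tnth => k; rewrite !tnth_mktuple.
pose F (w : Omega) := \int[P]_w' G (w, w').
have mF : measurable_fun setT F.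
  by apply: (measurable_fun_fubini_tonelli_F G).
have F0 w : 0 <= F w by apply: integral_ge0 => w' _.
(* [F] is the conditional expectation of [G] given the first sample; Markov's inequality bounds the
   probability of [D]. *)
pose D := [set w | (expR u)%:E <= F w].
have mD : measurable D.
  rewrite /D -[X in measurable X]setTI; exact: emeasurable_fun_c_infty.
exists D; split => //.
  rewrite -(@lee_pmul2l _ (expR u)%:E) ?lte_fin ?expR_gt0//.
  rewrite -EFinM mulrCA expRxMexpNx_1 mulr1; apply: le_trans intG.
  rewrite (fubini_tonelli1 G)// -integral_cst//.
  apply: (@le_trans _ _ (\int[P]_(w in D) F w)).
    apply: ge0_le_integral => //.
    - by move=> w _; rewrite lee_fin expR_ge0.
    - exact: measurable_funTS.
  by apply: ge0_subset_integral.
move=> w Dw S AS mS uS.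
rewrite leNgt; apply/negP => Nw; apply: Dw; rewrite /D /=.
set N := count_in Z w S in Nw.
apply: (@le_trans _ _ (\int[P]_w' ((expR (ga * N))%:E *
    (expR (al * count_in Z w' S))%:E))).
  rewrite ge0_integralZl_EFin ?expR_ge0//; last first.
    apply/measurable_EFinP; apply: measurableT_comp => //.
    by apply: measurable_funM => //; exact: measurable_count.
  apply: (@le_trans _ _ ((expR (ga * N))%:E *
      (expR (al * (n%:R * fine (mu S))))%:E)).
    (* With [m] the mean count, [N < 2/3 * m] and [ga <= 0] give [ga * N + al * m >= (al + 2/3 * ga)
       * m >= m / 36 >= u]. *)
    rewrite -EFinM lee_fin -expRD ler_expR.
    have := al_ga; have := ga_le0; have : (0 <= n%:R * fine (mu S))%R.
      by rewrite mulr_ge0// fine_ge0.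
    set m := (n%:R * fine (mu S))%R in uS Nw *; nra.
  by rewrite lee_pmul2l ?lte_fin ?expR_gt0//; exact: mgf_count.
apply: ge0_le_integral => //.
- apply: emeasurable_funM => //; apply/measurable_EFinP.
  apply: measurableT_comp => //.
  by apply: measurable_funM => //; exact: measurable_count.
- by apply: measurableT_comp => //; exact: measurable_pair1.
move=> w' _.
(* The trace of the cell itself on the doubled sample: its single term in [G] already suffices. *)
pose b : {ffun 'I_(n + n) -> bool} := [ffun k => ghost Z k (w, w') \in S].
have Hb : H b (tG (w, w')).
  have [_ _ _ + _] := LH b; apply; exists S => // k.
  by rewrite ffunE tnth_mktuple; split => [/set_mem|/mem_set].
rewrite /G (bigD1 b)//= -[leLHS]adde0; apply: leeD; last first.
  by apply: sume_ge0 => b' _; rewrite lee_fin mulr_ge0.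
rewrite -EFinM lee_fin indicE mem_set// mul1r -expRD /N /count_in.
rewrite !mulr_sumr -big_split/= expR_sum; apply: ler_prod => i _.
rewrite wtE expR_ge0 /= !ffunE /ghost (unsplitK (inl _ i)) (unsplitK (inr _ i)).
by rewrite !indicE.
Qed.

End Deviation.

(** * Sub-Gaussian noise summed over the points of a cell, uniformly over the class *)

Section Noise.
Context {R : realType} {dT : measure_display} {T : measurableType dT}.
Context {dS : measure_display} {S : measurableType dS}.
Context {dO : measure_display} {Omega : measurableType dO}.
Variable P : probability Omega R.
Variables (n : nat) (Z : 'I_n -> Omega -> T) (mu : probability T R).
Hypothesis mZ : forall i, measurable_fun setT (Z i).
Hypothesis Zmu : has_product_law P Z mu.
Variable phi : T -> S.
Hypothesis mphi : measurable_fun setT phi.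

Let replaced (i j : 'I_n) (wt : Omega * T) : T :=
  if j == i then wt.2 else Z j wt.1.

Let measurable_replaced i j : measurable_fun setT (replaced i j).
Proof.
rewrite /replaced; case: eqP => _; first exact: measurable_snd.
exact: (measurableT_comp (mZ j) measurable_fst).
Qed.

Let replaced_law i : has_product_law (P \x mu) (replaced i) mu.
Proof.
move=> B mB; rewrite (bigD1 i)//=.
pose C (j : 'I_n) := if j == i then setT else B j.
have mC j : measurable (C j) by rewrite /C; case: ifP.
have -> : [set w | forall j, B j (replaced i j w)] =
    [set w | forall j, C j (Z j w)] `*` B i.
  apply/seteqP; split => -[w t] /=.
    move=> Bw; split; last by have := Bw i; rewrite /replaced eqxx.
    by move=> j; have := Bw j; rewrite /C /replaced; case: ifP.
  by move=> [Cw Bt] j; have := Cw j; rewrite /C /replaced; case: eqP => [->|].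
rewrite product_measure1E//; last first.
  have := measurable_mktuple mZ measurableT (measurable_rectangle mC).
  rewrite setTI; congr measurable; apply/seteqP.
  by split => w /= Cw j; have := Cw j; rewrite tnth_mktuple.
rewrite [X in X * _](Zmu mC) (bigD1 i)//= [in X in X * _ * _]/C eqxx.
rewrite probability_setT mul1e.
rewrite muleC; congr (_ * _); apply: eq_bigr => j ji.
by rewrite /C (negbTE ji).
Qed.

(* The factors are removed one at a time: resampling the i-th coordinate from
   mu does not change the law of the sample, and makes the i-th factor
   independent of the others. *)
Lemma mgf_factor (e : T -> R) (c : R) (r : seq 'I_n) (D : set (n.-tuple S)) :
  measurable_fun setT e -> (forall t, 0 <= e t)%R -> (0 <= c)%R ->
  (forall C, measurable C ->
    \int[mu]_(t in phi @^-1` C) (e t)%:E <= c%:E * mu (phi @^-1` C)) ->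
  measurable D -> uniq r ->
  \int[P]_w (\1_D [tuple phi (Z i w) | i < n] * \prod_(i <- r) e (Z i w))%:E <=
  (c ^+ size r)%:E * P [set w | D [tuple phi (Z i w) | i < n]].
Proof.
move=> me e0 c0 ec mD.
have mmap : measurable_fun [set: n.-tuple T]
    (fun z => [tuple phi (tnth z i) | i < n]).
  by apply: measurable_mktuple => i; apply: measurableT_comp => //;
    exact: measurable_tnth.
pose f (r : seq 'I_n) (z : n.-tuple T) : \bar R :=
  (\1_D [tuple phi (tnth z i) | i < n] * \prod_(i <- r) e (tnth z i))%:E.
have mf r' : measurable_fun [set: n.-tuple T] (f r').
  apply/measurable_EFinP; apply: measurable_funM.
    by apply: measurableT_comp mmap; exact: measurable_indic.
  apply: measurable_prod => i _; apply: measurableT_comp => //.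
  exact: measurable_tnth.
have f0 r' z : 0 <= f r' z.
  by rewrite lee_fin mulr_ge0// ?prodr_ge0// indicE.
have fE r' : \int[P]_w (\1_D [tuple phi (Z i w) | i < n] *
    \prod_(i <- r') e (Z i w))%:E = \int[P]_w f r' [tuple Z i w | i < n].
  apply: eq_integral => w _; rewrite /f; congr (_ * _)%:E.
    by congr (\1_D _); apply: eq_from_tnth => i; rewrite !tnth_mktuple.
  by apply: eq_bigr => i _; rewrite tnth_mktuple.
elim: r => [_|i r IH /= /andP[ir ur]].
  rewrite expr0 mul1e fE.
  have mDZ : measurable [set w | D [tuple phi (Z i w) | i < n]].
    have mphiZ i : measurable_fun setT (phi \o Z i) by exact: measurableT_comp.
    by have := measurable_mktuple mphiZ measurableT mD; rewrite setTI.
  rewrite -[X in P X](setIT) -(integral_indic P measurableT mDZ).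
  apply: ge0_le_integral => //.
  - exact: (measurableT_comp (mf _) (measurable_mktuple mZ)).
  - by apply/measurable_EFinP; exact: measurable_indic.
  move=> w _; rewrite /f big_nil mulr1 lee_fin !indicE ler_nat.
  case: (boolP (_ \in D)) => // /set_mem Dw; rewrite mem_set//=.
  by move: Dw; congr D; apply: eq_from_tnth => j; rewrite !tnth_mktuple.
have fubini r' : \int[P]_w f r' [tuple Z j w | j < n] =
    \int[P]_w \int[mu]_t f r' [tuple replaced i j (w, t) | j < n].
  rewrite (has_product_law_integral mZ (measurable_replaced i) Zmu
    (replaced_law i) (mf r') (f0 r')).
  rewrite (fubini_tonelli1 (fun wt => f r' [tuple replaced i j wt | j < n]))//.
  exact: (measurableT_comp (mf r') (measurable_mktuple (measurable_replaced i))).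
have mfub r' : measurable_fun setT (fun w =>
    \int[mu]_t f r' [tuple replaced i j (w, t) | j < n]).
  apply: (measurable_fun_fubini_tonelli_F
    (fun wt => f r' [tuple replaced i j wt | j < n])) => //.
  exact: (measurableT_comp (mf r') (measurable_mktuple (measurable_replaced i))).
have cE0 : 0 <= c%:E by rewrite lee_fin.
rewrite exprS EFinM -muleA; apply: le_trans (lee_wpmul2l cE0 (IH ur)).
rewrite !fE !fubini -ge0_integralZl_EFin//; last first.
  by move=> w _; apply: integral_ge0 => t _.
apply: ge0_le_integral => //.
+ by move=> w _; apply: integral_ge0 => t _.
+ exact: measurable_funeM.
move=> w _.
pose pr : R := (\prod_(j <- r) e (Z j w))%R.
have pr0 : (0 <= pr)%R by exact: prodr_ge0.
(* Once the other points are frozen, the event [D] constrains only [phi] of the fresh point, which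
   is the form of event that the hypothesis on [e] controls. *)
pose Dw : set S :=
  [set s | D [tuple if j == i then s else phi (Z j w) | j < n]].
have mDw : measurable Dw.
  have mins : measurable_fun setT
      (fun s : S => [tuple if j == i then s else phi (Z j w) | j < n]).
    by apply: measurable_mktuple => j; case: (j == i).
  by have := mins measurableT _ mD; rewrite setTI.
have mpDw : measurable (phi @^-1` Dw).
  by rewrite -[X in measurable X]setTI; exact: mphi.
have indE t : \1_D [tuple phi (tnth [tuple replaced i j (w, t) | j < n] i0)
    | i0 < n] = \1_(phi @^-1` Dw) t :> R.
  rewrite !indicE; congr (_%:R); congr nat_of_bool.
  apply/idP/idP => /set_mem DD; apply/mem_set; move: DD; congr D;
  by apply: eq_from_tnth => j; rewrite !tnth_mktuple /replaced; case: eqP.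
have prE t : (\prod_(j <- r) e (tnth [tuple replaced i j (w, t) | j < n] j))%R
    = pr.
  rewrite /pr [LHS]big_seq [RHS]big_seq; apply: eq_bigr => j jr.
  rewrite tnth_mktuple /replaced; have [ji|//] := eqVneq j i.
  by rewrite -ji jr in ir.
under eq_integral => t _.
  rewrite /f indE big_cons prE tnth_mktuple /replaced eqxx/= mulrA EFinM.
  over.
under [in leRHS]eq_integral => t _ do rewrite /f indE prE EFinM.
rewrite !ge0_integralZr//; last 3 first.
- by apply/measurable_EFinP; exact: measurable_indic.
- by apply/measurable_EFinP; apply: measurable_funM => //;
  exact: measurable_indic.
- by move=> t _; rewrite lee_fin mulr_ge0// indicE.
rewrite muleA lee_wpmul2r ?lee_fin//.
rewrite integral_indic// setIT; apply: le_trans (ec _ mDw).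
rewrite [leRHS]integral_mkcond; apply: ge0_le_integral => //.
- by move=> t _; rewrite lee_fin mulr_ge0// indicE.
- by apply/measurable_EFinP; apply: measurable_funM => //;
  exact: measurable_indic.
- apply/(measurable_restrictT _ mpDw).1; apply/measurable_EFinP.
  exact: measurable_funTS.
- move=> t _; rewrite patchE indicE.
  by case: (t \in _); rewrite ?mul1r ?mul0r.
Qed.

Variables (eps : T -> R) (sigma : R).
Hypothesis meps : measurable_fun setT eps.
Hypothesis sigma_gt0 : (0 < sigma)%R.
Hypothesis eps_sub : forall (s : R) C, measurable C ->
  \int[mu]_(t in phi @^-1` C) (expR (s * eps t))%:E <=
  (expR (s ^+ 2 * sigma ^+ 2 / 2))%:E * mu (phi @^-1` C).

Let mphiZ i : measurable_fun setT (fun w => phi (Z i w)).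
Proof. exact: measurableT_comp. Qed.

Let measurable_preimage_phiZ (D : set (n.-tuple S)) : measurable D ->
  measurable [set w | D [tuple phi (Z i w) | i < n]].
Proof.
by move=> mD; have := measurable_mktuple mphiZ measurableT mD; rewrite setTI.
Qed.

Lemma measurable_noise_gt (b : {ffun 'I_n -> bool}) (D : set (n.-tuple S)) x :
  measurable D ->
  measurable [set w | D [tuple phi (Z i w) | i < n] /\
                      (x < \sum_(i < n | b i) eps (Z i w))%R].
Proof.
move=> mD; apply: measurableI; first exact: measurable_preimage_phiZ.
have mf : measurable_fun setT (fun w => \sum_(i < n | b i) eps (Z i w))%R.
  under eq_fun do rewrite -big_filter.
  by apply: measurable_sum => i; exact: measurableT_comp.
have := mf measurableT _ (measurable_itv `]x, +oo[).
rewrite setTI; congr measurable; apply/seteqP.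
by split => w /=; rewrite in_itv/= andbT.
Qed.

(** Exponential Markov inequality on the event [D]. As [D] depends on the covariates alone, each
    selected point still costs only [expR (s ^+ 2 * sigma ^+ 2 / 2)], and the probability of [D]
    survives as a factor. *)
Lemma chernoff_noise (b : {ffun 'I_n -> bool}) (D : set (n.-tuple S))
    (s x : R) :
  measurable D -> (0 <= s)%R ->
  P [set w | D [tuple phi (Z i w) | i < n] /\
             (x < \sum_(i < n | b i) eps (Z i w))%R] <=
  (expR ((count b (index_enum 'I_n))%:R *
    (s ^+ 2 * sigma ^+ 2 / 2) - s * x))%:E *
  P [set w | D [tuple phi (Z i w) | i < n]].
Proof.
move=> mD s0; set E := [set w | _ /\ _].
have mE : measurable E by exact: measurable_noise_gt.
pose r := [seq i <- index_enum 'I_n | b i].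
have ur : uniq r by rewrite filter_uniq// index_enum_uniq.
have me : measurable_fun setT (fun t => expR (s * eps t)).
  by apply: measurableT_comp => //; exact: measurable_funM.
pose f w : R := (\1_D [tuple phi (Z i w) | i < n] *
  \prod_(i <- r) expR (s * eps (Z i w)))%R.
have f0 w : (0 <= f w)%R by rewrite mulr_ge0// ?prodr_ge0// indicE.
have mf : measurable_fun setT f.
  apply: measurable_funM.
    apply: measurableT_comp (measurable_mktuple mphiZ).
    exact: measurable_indic.
  by apply: measurable_prod => i _; exact: measurableT_comp me (mZ i).
have := mgf_factor me (fun=> expR_ge0 _) (expR_ge0 _) (@eps_sub s) mD ur.
rewrite size_filter -expRM_natl -/(f _) => mgf.
rewrite expRD [in leRHS]mulrC EFinM -muleA.
apply: le_trans (lee_wpmul2l _ mgf); last by rewrite lee_fin expR_ge0.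
rewrite -ge0_integralZl_EFin ?expR_ge0//; last 2 first.
- by move=> w _; rewrite lee_fin; exact: f0.
- exact/measurable_EFinP.
rewrite -[X in P X]setIT -integral_indic//.
apply: ge0_le_integral => //.
- by apply/measurable_EFinP; exact: measurable_indic.
- by apply: measurable_funeM; exact/measurable_EFinP.
move=> w _; rewrite indicE -EFinM lee_fin.
have [/set_mem[Dw xw]|_] := boolP (w \in E); last first.
  by rewrite mulr_ge0 ?expR_ge0 ?f0.
rewrite /f indicE mem_set// mul1r -expR_sum -expRD -expR0 ler_expR.
by rewrite /r big_filter -mulr_sumr addrC -mulrBr mulr_ge0// subr_ge0 ltW.
Qed.

(** Union bound over all labellings. The threshold grows with the number of selected points so that
    each labelling has the same exponent [- La]; the factors [Q (H b)] then sum to at most the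
    growth function. *)
Lemma uniform_noise (A : set (set S)) (v : nat) (La : R) :
  has_vc_dim A v -> permissible R A -> (0 <= La)%R ->
  exists D : set Omega, [/\ measurable D,
    P D <= ((n.+1 ^ v)%:R * expR (- La))%:E &
    forall w, ~ D w -> forall U, A U ->
      (\sum_(i < n) eps (Z i w) * \1_U (phi (Z i w)) <=
       Num.sqrt (2 * sigma ^+ 2 * La *
         count_in (fun i w => phi (Z i w)) w U))%R].
Proof.
move=> hvc hmeas La0.
pose tZ : {mfun Omega >-> n.-tuple S} :=
  mfun_Sub (mem_set (measurable_mktuple mphiZ)).
pose Q : probability (n.-tuple S) R := distribution P tZ.
have [L [H LH]] := permissible_hull Q hmeas.
have mH b : measurable (H b) by have [] := LH b.
pose x (k : nat) : R := Num.sqrt (2 * sigma ^+ 2 * La * k%:R).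
pose k (b : {ffun 'I_n -> bool}) := count b (index_enum 'I_n).
pose E (b : {ffun 'I_n -> bool}) := [set w | H b [tuple phi (Z i w) | i < n] /\
  (x (k b) < \sum_(i < n | b i) eps (Z i w))%R].
have mE b : measurable (E b) by exact: measurable_noise_gt.
have PE b : P (E b) <= (expR (- La))%:E * Q (H b).
  (* With no selected point the optimal [s] below would divide by zero; the sum is then empty and
     cannot exceed a nonnegative threshold. *)
  have [b0|b0] := posnP (k b).
    rewrite (_ : E b = set0) ?measure0 ?mule_ge0 ?lee_fin ?expR_ge0//.
    apply/seteqP; split => // w [_]; rewrite big_hasC.
      by rewrite ltNge sqrtr_ge0.
    by rewrite has_count -leqNgt -/(k b) b0.
  have kpos : (0 < (k b)%:R :> R)%R by rewrite ltr0n.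
  have sp : (0 < (k b)%:R * sigma ^+ 2)%R by rewrite mulr_gt0// exprn_gt0.
  (* This [s] minimizes [k * s^2 * sigma^2 / 2 - s * x]; the minimum [- x^2 / (2 * k * sigma^2)]
     equals [- La]. *)
  have s0 : (0 <= x (k b) / ((k b)%:R * sigma ^+ 2))%R.
    by rewrite divr_ge0 ?sqrtr_ge0// ltW.
  apply: (le_trans (chernoff_noise b (x (k b)) (mH b) s0)).
  rewrite lee_wpmul2r// lee_fin ler_expR le_eqVlt; apply/orP; left; apply/eqP.
  have xx : (x (k b) ^+ 2 = 2 * sigma ^+ 2 * La * (k b)%:R)%R.
    by rewrite sqr_sqrtr// mulr_ge0// mulr_ge0// mulr_ge0 ?sqr_ge0.
  transitivity (- (x (k b) ^+ 2 / (2 * ((k b)%:R * sigma ^+ 2))))%R.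
    by field; rewrite ?lt0r_neq0.
  by rewrite xx; field; rewrite ?lt0r_neq0.
exists (\big[setU/set0]_b E b); split.
- by apply: bigsetU_measurable => b _.
- apply: (@le_trans _ _ (\sum_b P (E b))).
    suff [] : measurable (\big[setU/set0]_b E b) /\
      P (\big[setU/set0]_b E b) <= \sum_b P (E b) by [].
    elim/big_rec2 : _ => [|b q D _ [mD PD]]; first by rewrite measure0.
    split; first exact: measurableU.
    by apply: (le_trans (measureU2 _ _ _)) => //; exact: leeD.
  apply: (@le_trans _ _ (\sum_b (expR (- La))%:E * Q (H b))).
    by apply: lee_sum => b _.
  rewrite -ge0_sume_distrr// mulrC EFinM lee_wpmul2l ?lee_fin ?expR_ge0//.
  by apply: sum_hull_le LH _ => z; exact: card_traces.
move=> w Dw U AU.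
rewrite leNgt; apply/negP => xw; apply: Dw.
pose b : {ffun 'I_n -> bool} := [ffun i => phi (Z i w) \in U].
rewrite -bigcup_seq; exists b => /=; first by rewrite mem_index_enum.
split.
  have [_ _ _ + _] := LH b; apply; exists U => // i.
  by rewrite ffunE tnth_mktuple; split => [/set_mem|/mem_set].
rewrite /x; have -> : ((k b)%:R = count_in (fun i w => phi (Z i w)) w U :> R)%R.
  rewrite /count_in /k -sum1_count natr_sum big_mkcond/=; apply: eq_bigr => i _.
  by rewrite ffunE indicE; case: ifP.
rewrite (lt_le_trans xw)// [leRHS]big_mkcond/=; apply: ler_sum => i _.
by rewrite ffunE indicE; case: ifP; rewrite ?mulr1 ?mulr0.
Qed.

End Noise.

(** * From the probabilistic hypotheses to product laws and integrated bounds *)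

Lemma product_law_comp (R : realType) (dT : measure_display)
    (T : measurableType dT) (dS : measure_display) (S : measurableType dS)
    (dO : measure_display) (Omega : measurableType dO)
    (P : probability Omega R) m (Z : 'I_m -> Omega -> T) (mu : set T -> \bar R)
    (phi : T -> S) : measurable_fun setT phi ->
  has_product_law P Z mu ->
  has_product_law P (fun i w => phi (Z i w)) (fun C => mu (phi @^-1` C)).
Proof.
move=> mphi Zmu B mB; rewrite -Zmu// => i.
by rewrite -[X in measurable X]setTI; exact: mphi.
Qed.

(** Taking the full space at index [None] removes the generic pair from the product rule; identical
    distribution then expresses each factor by the law of that pair. *)
Lemma product_law_pairs (R : realType) (dO : measure_display)
    (Omega : measurableType dO) (P : probability Omega R) (dT : measure_display)
    (T : measurableType dT) n (Z : option 'I_n -> Omega -> T) :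
  mutually_independent P Z -> identically_distributed P Z ->
  has_product_law P (fun i => Z (Some i)) (fun C => P (Z None @^-1` C)).
Proof.
move=> indep ident B mB.
pose B' (o : option 'I_n) := if o is Some i then B i else setT.
have mB' o : measurable (B' o) by case: o => /=.
transitivity (P [set w | forall o, B' o (Z o w)]).
  congr (P _); apply/seteqP; split => w /= Bw; first by case.
  by move=> i; exact: (Bw (Some i)).
rewrite (indep _ mB') (bigD1 None)//= preimage_setT probability_setT mul1e.
rewrite (reindex_omap Some id)/=; last by case.
apply: eq_big => [i|i _]; first by rewrite eqxx.
exact: ident.
Qed.

(** Puts the conditional moment bound in the integrated form used for the noise. A version [h] may
    take negative values, so its positive part is what gets compared with [c]. *)
Lemma cond_exp_le (R : realType) (dO : measure_display)
    (Omega : measurableType dO) (P : probability Omega R) (dT : measure_display)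
    (T : measurableType dT) (X : {RV P >-> T}) (f : Omega -> R) (h : T -> R)
    (c : R) (C : set T) :
  is_cond_exp P X f h -> {ae P, forall w, (h (X w) <= c)%R} -> (0 <= c)%R ->
  measurable C ->
  \int[P]_(w in X @^-1` C) (f w)%:E <= c%:E * P (X @^-1` C).
Proof.
move=> [_ mh _ fh] hc c0 mC; rewrite fh//.
have mXC : measurable (X @^-1` C).
  by rewrite -[X in measurable X]setTI; exact: measurable_funPT.
have mhX : measurable_fun (X @^-1` C) (fun w => (h (X w))%:E).
  apply: measurable_funTS; apply/measurable_EFinP.
  by apply: measurableT_comp.
rewrite -integral_cst// [leLHS]integralE.
apply: (@le_trans _ _ (\int[P]_(w in X @^-1` C) (fun w => (h (X w))%:E)^\+ w)).
  rewrite -[leRHS]sube0; apply: leeB => //.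
  by apply: integral_ge0 => w _; exact: funeneg_ge0.
apply: ae_ge0_le_integral => //.
- exact: measurable_funepos.
- apply: filterS hc => w hw _; rewrite funeposE ge_max lee_fin hw/=.
  by rewrite lee_fin.
Qed.

(** * Deterministic bounds: bias, noise level and error decomposition *)

Lemma lebesgue_tuple_ge0 (R : realType) d (A : set (d.-tuple R)) :
  0 <= lebesgue_tuple A.
Proof.
elim: d A => [|d IH] A /=; first exact: measure_ge0.
by apply: integral_ge0.
Qed.

Lemma l2dist_ge0 (R : realType) d (x y : d.-tuple R) : (0 <= l2dist x y)%R.
Proof. exact: sqrtr_ge0. Qed.

Lemma lip_const_ge0 (R : realType) d (g : d.-tuple R -> R) V :
  0 <= lip_const g V.
Proof. by apply: le_ereal_inf_tmp => _ [c [c0 _] <-]; rewrite lee_fin. Qed.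

Lemma diam2_ge0 (R : realType) d (V : set (d.-tuple R)) x : V x -> 0 <= diam2 V.
Proof.
move=> Vx; apply: (@le_trans _ _ (l2dist x x)%:E).
  by rewrite lee_fin l2dist_ge0.
by apply: ereal_sup_ubound; exists x => //; exists x.
Qed.

(** Every admissible constant is at least the quotient of [|g x - g y|] by the distance, hence so is
    the infimum. At distance zero the finite constant [L] forces [g x = g y]. *)
Lemma lip_const_diam2 (R : realType) d (g : d.-tuple R -> R)
    (V : set (d.-tuple R)) (L : R) x y :
  (forall x y, V x -> V y -> (`|g x - g y| <= L * l2dist x y)%R) ->
  V x -> V y -> `|g x - g y|%:E <= lip_const g V * diam2 V.
Proof.
move=> gL Vx Vy; have [xy0|xy0] := eqVneq (l2dist x y) 0%R.
  apply: (@le_trans _ _ 0).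
    by rewrite lee_fin (le_trans (gL _ _ Vx Vy))// xy0 mulr0.
  by rewrite mule_ge0 ?lip_const_ge0// (diam2_ge0 Vx).
have xy : (0 < l2dist x y)%R by rewrite lt0r xy0 l2dist_ge0.
apply: (@le_trans _ _ (lip_const g V * (l2dist x y)%:E)); last first.
  rewrite lee_wpmul2l ?lip_const_ge0//.
  by apply: ereal_sup_ubound; exists x => //; exists y.
rewrite -lee_pdivrMr//; apply: le_ereal_inf_tmp => _ [c [c0 gc] <-].
by rewrite lee_pdivrMr// -EFinM lee_fin gc.
Qed.

(** Dividing by [N] leaves [2 * sigma^2 * La / N] under the root, and [N >= 2/3 * q] turns the
    constant 2 into 3. *)
Lemma local_noise_le (R : realType) (sigma La q N s : R) :
  (0 <= La)%R -> (0 < q)%R -> (2 * q <= 3 * N)%R ->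
  (s <= Num.sqrt (2 * sigma ^+ 2 * La * N))%R ->
  (s / N <= Num.sqrt (3 * sigma ^+ 2 / q * La))%R.
Proof.
move=> La0 q0 qN sN.
have N0 : (0 < N)%R by lra.
have [q0' N0'] : (0 <= q)%R /\ (0 <= N)%R by split; exact: ltW.
rewrite ler_pdivrMr// (le_trans sN)//.
rewrite -[X in (_ <= _ * X)%R](ger0_norm N0') -sqrtr_sqr.
rewrite -sqrtrM; last first.
  by rewrite mulr_ge0// divr_ge0// mulr_ge0 ?sqr_ge0.
apply: ler_wsqrtr.
rewrite -subr_ge0.
rewrite (_ : _ - _ = sigma ^+ 2 * La * N / q * (3 * N - 2 * q))%R; last first.
  by field; rewrite lt0r_neq0.
by rewrite mulr_ge0 ?subr_ge0// divr_ge0// mulr_ge0// mulr_ge0 ?sqr_ge0.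
Qed.

(** As [N > 0], the weights [a i / N] sum to 1, so the error is a weighted mean of noises plus a
    weighted mean of [gX i - gx], where only points of nonzero weight count. *)
Lemma local_error_le (R : realType) n (Y gX a : 'I_n -> R) (gx B1 B2 : R) :
  let N := (\sum_(i < n) a i)%R in
  (forall i, 0 <= a i)%R -> (0 < N)%R ->
  (\sum_(i < n) (Y i - gX i) * a i <= B1 * N)%R ->
  (\sum_(i < n) - (Y i - gX i) * a i <= B1 * N)%R ->
  (forall i, a i != 0 -> `|gX i - gx| <= B2)%R ->
  (`|(\sum_(i < n) Y i * a i) / N - gx| <= B1 + B2)%R.
Proof.
move=> N a0 N0 up lo bias.
have -> : ((\sum_(i < n) Y i * a i) / N - gx =
    (\sum_(i < n) (Y i - gX i) * a i) / N +
    (\sum_(i < n) (gX i - gx) * a i) / N)%R.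
  apply: (mulIf (lt0r_neq0 N0)).
  rewrite -mulrDl mulrBl !divfK ?lt0r_neq0// -big_split/= mulr_sumr -sumrB.
  by apply: eq_bigr => i _; ring.
apply: le_trans (ler_normD _ _) _; apply: lerD;
  rewrite normrM normfV (gtr0_norm N0) ler_pdivrMr//.
  rewrite ler_norml up andbT lerNl -sumrN.
  by under eq_bigr do rewrite -mulNr.
rewrite mulr_sumr; apply: le_trans (ler_norm_sum _ _ _) _.
apply: ler_sum => i _; rewrite normrM (ger0_norm (a0 i)).
have [->|ai] := eqVneq (a i) 0%R; first by rewrite !mulr0.
by rewrite ler_wpM2r// bias.
Qed.

(** * The local regression bound on the intersection of the good events *)

Theorem theorem7 (R : realType) (d n v : nat) (dO : measure_display)
    (Omega : measurableType dO) (P : probability Omega R)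
    (SX : set (d.-tuple R))
    (X : {RV P >-> d.-tuple R}) (Y : {RV P >-> R})
    (Xs : 'I_n -> {RV P >-> d.-tuple R}) (Ys : 'I_n -> {RV P >-> R})
    (g : d.-tuple R -> R) (V : Omega -> d.-tuple R -> set (d.-tuple R))
    (A : set (set (d.-tuple R))) (l : d.-tuple R -> R)
    (sigma L delta : R)
    (hd : (1 <= d)%N) (hn : (1 <= n)%N) (hdelta : (0 < delta < 1 / 3)%R)
    (hSX : {ae P, forall w, SX (X w)})
    (hg : is_cond_exp P X Y g)
    (hV : local_map SX V)
    (* (a) *)
    (hindep : mutually_independent P (pairs X Y Xs Ys))
    (hident : identically_distributed P (pairs X Y Xs Ys))
    (* (b) *)
    (hsigma : (0 < sigma)%R)
    (hsub : cond_subgaussian P X (fun w => Y w - g (X w))%R sigma)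
    (* (c) *)
    (hL : forall x y, SX x -> SX y -> (`|g x - g y| <= L * l2dist x y)%R)
    (* (d) *)
    (hl0 : forall x, SX x -> (0 < l x)%R)
    (hl : {ae P, forall w, forall x, SX x ->
            (l x)%:E * lebesgue_tuple (V w x) <= distribution P X (V w x)})
    (* (e) *)
    (hvc : has_vc_dim A v) (hmeas : permissible R A)
    (hVA : forall w x, SX x -> A (V w x))
    (hlarge : large SX X Xs V v delta) :
  exists E : set Omega,
    [/\ measurable E, (1 - 3 * delta)%:E <= P E &
        forall w, E w -> forall x, SX x ->
          `|local_estimator Xs Ys V w x - g x|%:E <=
          noise_bound n v sigma delta (l x) (lebesgue_tuple (V w x)) +
          lip_const g (V w x) * diam2 (V w x)].
Proof.
have /andP[d0 d13] := hdelta.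
have [_ mgg _ _] := hg.
pose XY : {RV P >-> (d.-tuple R * R)%type} :=
  mfun_Sub (mem_set
    (measurable_fun_pair (measurable_funPT X) (measurable_funPT Y))).
pose mu : probability (d.-tuple R * R)%type R := distribution P XY.
pose Z (i : 'I_n) (w : Omega) := (Xs i w, Ys i w).
have mZ i : measurable_fun setT (Z i) by exact: measurable_fun_pair.
have Zmu : has_product_law P Z mu := product_law_pairs hindep hident.
have Xmu : has_product_law P (fun i => Xs i : Omega -> _) (distribution P X).
  exact: product_law_comp measurable_fst Zmu.
pose eps (t : d.-tuple R * R) : R := (t.2 - g t.1)%R.
have meps : measurable_fun setT eps.
  apply: measurable_funB => //; exact: measurableT_comp.
have eps_sub (s : R) C : measurable C ->
    \int[mu]_(t in fst @^-1` C) (expR (s * eps t))%:E <=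
    (expR (s ^+ 2 * sigma ^+ 2 / 2))%:E * mu (fst @^-1` C).
  move=> mC; rewrite ge0_integral_pushforward//.
  - have [_ /(_ s)[h hE hc]] := hsub.
    exact: (cond_exp_le hE hc (expR_ge0 _) mC).
  - by rewrite -[X in measurable X]setTI; exact: measurable_fst.
  - apply: measurable_funTS; apply/measurable_EFinP.
    by apply: measurableT_comp => //; exact: measurable_funM.
(* The noise inequality is one-sided; the opposite noise satisfies the same moment bound with [- s]
   in place of [s]. *)
have nmeps : measurable_fun setT (fun t => - eps t)%R by exact: measurable_funN.
have neps_sub (s : R) C : measurable C ->
    \int[mu]_(t in fst @^-1` C) (expR (s * - eps t))%:E <=
    (expR (s ^+ 2 * sigma ^+ 2 / 2))%:E * mu (fst @^-1` C).
  move=> mC; have := eps_sub (- s)%R C mC; rewrite sqrrN; apply: le_trans.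
  by under eq_integral do rewrite mulrN -mulNr.
pose La : R := ln ((n + 1)%:R ^+ v / delta).
pose u : R := ln (4 * (2 * n + 1)%:R ^+ v / delta).
have pow1 (k : nat) : (1 <= (k + 1)%:R ^+ v :> R)%R.
  by rewrite exprn_ege1// ler1n addn1.
have La0 : (0 <= La)%R.
  apply: ln_ge0; rewrite ler_pdivlMr// mul1r; have := pow1 n; lra.
(* [La] is the level at which each one-sided noise event fails with probability at most [delta]. *)
have expLa : ((n.+1 ^ v)%:R * expR (- La) = delta)%R.
  rewrite expRN lnK; last by rewrite posrE divr_gt0// (lt_le_trans ltr01).
  by rewrite natrX addn1 invf_div mulrCA divff ?mulr1// expf_neq0// pnatr_eq0.
(* The growth function is taken at the doubled sample size, and [36 * u] is the largeness threshold.
   The product is in fact [delta / 4]. *)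
have expu : (((n + n).+1 ^ v)%:R * expR (- u) <= delta)%R.
  have p0 := lt_le_trans ltr01 (pow1 (2 * n)%N).
  rewrite expRN lnK; last by rewrite posrE divr_gt0// mulr_gt0.
  rewrite natrX -addn1 addnn -mul2n invf_div.
  rewrite (_ : _ * _ = delta / 4)%R; first lra.
  by field; rewrite lt0r_neq0.
have [D1 [mD1 PD1 nD1]] :=
  uniform_noise mZ Zmu measurable_fst meps hsigma eps_sub hvc hmeas La0.
have [D2 [mD2 PD2 nD2]] :=
  uniform_noise mZ Zmu measurable_fst nmeps hsigma neps_sub hvc hmeas La0.
have mXs (i : 'I_n) : measurable_fun setT (Xs i) by [].
have [D3 [mD3 PD3 nD3]] := relative_deviation mXs Xmu u hvc hmeas.
rewrite expLa in PD1 PD2.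
have {}PD3 : P D3 <= delta%:E by apply: le_trans PD3 _; rewrite lee_fin.
have [N1 [mN1 PN1 nN1]] := hl.
have [N2 [mN2 PN2 nN2]] := hlarge.
(* Three events of probability at most [delta], and the null sets outside which the density bound
   and largeness hold. *)
pose D := D1 `|` (D2 `|` (D3 `|` (N1 `|` N2))).
have mD : measurable D by do 4 apply: measurableU => //.
exists (~` D); split; first exact: measurableC.
  rewrite probability_setC// EFinB leeB//.
  have mN : measurable (N1 `|` N2) by exact: measurableU.
  have mN3 : measurable (D3 `|` (N1 `|` N2)) by exact: measurableU.
  have mN23 : measurable (D2 `|` (D3 `|` (N1 `|` N2))) by exact: measurableU.
  have PN : P (N1 `|` N2) <= 0.
    apply: (le_trans (measureU2 _ _ _)) => //.
    by rewrite [X in X + _]PN1 [X in _ + X]PN2 adde0.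
  rewrite (_ : 3 * delta = delta + (delta + (delta + 0)))%R; last by ring.
  rewrite !EFinD.
  do 3 (apply: (le_trans (measureU2 _ _ _)) => //; apply: leeD => //).
move=> w /not_orP[nw1 /not_orP[nw2 /not_orP[nw3 /not_orP[nw4 nw5]]]] x SXx.
have {nw4}ll := (contra_notP (@nN1 w) nw4) x SXx.
have {nw5}lrg := (contra_notP (@nN2 w) nw5) x SXx.
have [mV VSX Vx] := hV w x SXx.
have AV := hVA w x SXx.
set S := V w x in ll lrg mV VSX Vx AV *.
have bias y : S y -> `|g y - g x|%:E <= lip_const g S * diam2 S.
  move=> Sy; apply: (lip_const_diam2 (L := L)) => // y1 y2 Sy1 Sy2.
  by apply: hL; exact: VSX.
have bias0 : 0 <= lip_const g S * diam2 S.
  by rewrite mule_ge0 ?lip_const_ge0// (diam2_ge0 Vx).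
(* For a cell of Lebesgue measure zero the bound is [+oo], the bias term being nonnegative. *)
rewrite /noise_bound; case: ifPn => [_|la0].
  by rewrite addye ?leey// gt_eqF// (lt_le_trans _ bias0)// ltNy0.
have lpos : 0 < lebesgue_tuple S by rewrite lt0e la0 lebesgue_tuple_ge0.
have lx0 := hl0 x SXx.
set pS := distribution P X S in ll lrg.
have pfin : pS \is a fin_num by exact: fin_num_measure.
(* An infinite volume would make [P^X] of the cell infinite by the density bound, so [fine] returns
   the true volume here. *)
have lfin : lebesgue_tuple S \is a fin_num.
  rewrite ge0_fin_numE ?ltW// ltey; apply/eqP => loo; move: ll.
  rewrite loo gt0_muley ?lte_fin// leye_eq.
  by apply/negP; move: pfin; rewrite fin_numE => /andP[].
set lam := fine (lebesgue_tuple S).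
have lam0 : (0 < lam)%R by rewrite fine_gt0// lpos ltey_eq lfin.
have lamp : (l x * lam <= fine pS)%R.
  by rewrite -lee_fin EFinM !fineK.
have n0 : (0 < n%:R :> R)%R by rewrite ltr0n.
set q := (n%:R * l x * lam)%R.
have q0 : (0 < q)%R by rewrite !mulr_gt0.
have qm : (q <= n%:R * fine pS)%R by rewrite /q -mulrA ler_wpM2l// ltW.
(* If the empirical mass dominates, the bound is immediate; otherwise the maximum in largeness is
   the true mass, and the deviation event applies. *)
have N23 : (2 / 3 * (n%:R * fine pS) <= count_in (fun i => Xs i) w S)%R.
  have [Pn|Pn] := leP (fine pS) (empirical Xs w S).
    have : (n%:R * fine pS <= count_in (fun i => Xs i) w S)%R.
      by rewrite mulrC -ler_pdivlMr.
    by have := lt_le_trans q0 qm; lra.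
  by apply: nD3 => //; rewrite (max_idPr (ltW Pn)) in lrg.
set N := count_in _ w S in N23.
have N0 : (0 < N)%R by lra.
have qN : (2 * q <= 3 * N)%R by lra.
(* An infinite bias term makes the claim trivial; otherwise the inequality is one between real
   numbers. *)
have [Boo|Bfin] := eqVneq (lip_const g S * diam2 S) +oo.
  by rewrite Boo addey// leey.
have Bf : lip_const g S * diam2 S \is a fin_num by rewrite ge0_fin_numE// ltey.
rewrite -(fineK Bf) -EFinD lee_fin /local_estimator.
have loc e : (\sum_(i < n) e (Z i w) * \1_S (Xs i w) <=
    Num.sqrt (2 * sigma ^+ 2 * La * N))%R ->
  (\sum_(i < n) e (Z i w) * \1_S (Xs i w) <=
    Num.sqrt (3 * sigma ^+ 2 / q * La) * N)%R.
  by rewrite -ler_pdivrMr//; exact: local_noise_le.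
apply: (@local_error_le _ _ _ (fun i => g (Xs i w)) (fun i => \1_S (Xs i w))).
- by move=> i; rewrite indicE.
- exact: N0.
- exact: (loc eps (nD1 w nw1 S AV)).
- exact: (loc (fun t => - eps t)%R (nD2 w nw2 S AV)).
- move=> i; rewrite indicE pnatr_eq0 eqb0 negbK => /set_mem Si.
  by rewrite -lee_fin fineK// bias.
Qed.
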